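(* Let $n\ge 1$ and let $K_n:(\sigma,\mu)$ be a complete fuzzy graph on $n$ vertices such that $\sigma$ is a $c$-constant function. Then $K_n$ is *-balanced.
   Context: A fuzzy graph $G:(\sigma,\mu)$ consists of a finite non-empty vertex set $V$, a function $\sigma:V\to(0,1]$, and a symmetric function $\mu:V\times V\to[0,1]$ with $\mu(u,v)\le \sigma(u)\wedge\sigma(v)$ for all $u,v$, where $\wedge$ denotes minimum. There are no loops: all conditions and sums over pairs $u,v\in V$ range over unordered pairs $\{u,v\}$ of distinct vertices. $G$ is complete if $\mu(u,v)=\sigma(u)\wedge\sigma(v)$ for all distinct $u,v\in V$. $\sigma$ is a $c$-constant function if $\sigma(v)=c$ for all $v\in V$ (so $c\in(0,1]$). The *-density of $G$ is $D^{\ast}(G)=\dfrac{2\sum_{u,v\in V}\mu(u,v)}{\sum_{u\in V}\sigma(u)}$. A non-empty fuzzy subgraph of $G$ is a fuzzy graph $H:(\sigma',\mu')$ on a non-empty set $W\subseteq V$ with $\sigma'(u)\le\sigma(u)$ and $\mu'(u,v)\le\mu(u,v)$ for all $u,v\in W$. $G$ is *-balanced if $D^{\ast}(H)\le D^{\ast}(G)$ for all non-empty fuzzy subgraphs $H$ of $G$. *)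

(* Defs.v *)
From HB Require Import structures.
From mathcomp Require Import all_boot all_order all_algebra.
Set Implicit Arguments.
Unset Strict Implicit.
Unset Printing Implicit Defensive.
Import Order.TTheory GRing.Theory Num.Theory.
Local Open Scope ring_scope.

(* Fuzzy graphs whose vertex set is a non-empty finite subset of a finite     *)
(* ambient type T, so that a graph and its subgraphs have the same type. The  *)
(* values of fsigma and fmu outside the vertex set are irrelevant, and so are *)
(* the diagonal values fmu u u: there are no loops.                           *)
Record fuzzy_graph (R : realFieldType) (T : finType) := FuzzyGraph {
  fvert : {set T};
  fsigma : T -> R;
  fmu : T -> T -> R;
  fvert_neq0 : fvert != set0;
  fsigma_range : {in fvert, forall u, 0 < fsigma u <= 1};
  fmu_range : {in fvert &, forall u v, 0 <= fmu u v <= 1};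
  fmu_sym : {in fvert &, forall u v, fmu u v = fmu v u};
  fmu_le : {in fvert &, forall u v,
              u != v -> fmu u v <= Num.min (fsigma u) (fsigma v)}
}.

Definition complete_fuzzy (R : realFieldType) (T : finType)
    (G : fuzzy_graph R T) : Prop :=
  {in fvert G &, forall u v,
     u != v -> fmu G u v = Num.min (fsigma G u) (fsigma G v)}.

Definition constant_sigma (R : realFieldType) (T : finType)
    (c : R) (G : fuzzy_graph R T) : Prop :=
  {in fvert G, forall v, fsigma G v = c}.

(* Each unordered pair of distinct vertices is counted once: of the two       *)
(* orderings, the one increasing for the enumeration of T is selected; the    *)
(* value does not depend on that enumeration since fmu is symmetric.          *)
Definition sum_mu (R : realFieldType) (T : finType) (G : fuzzy_graph R T) : R :=
  \sum_(u in fvert G)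
    \sum_(v in fvert G | (enum_rank u < enum_rank v)%N) fmu G u v.

Definition star_density (R : realFieldType) (T : finType)
    (G : fuzzy_graph R T) : R :=
  2%:R * sum_mu G / \sum_(u in fvert G) fsigma G u.

Definition fuzzy_subgraph (R : realFieldType) (T : finType)
    (H G : fuzzy_graph R T) : Prop :=
  [/\ fvert H \subset fvert G,
      {in fvert H, forall u, fsigma H u <= fsigma G u} &
      {in fvert H &, forall u v, u != v -> fmu H u v <= fmu G u v}].

Definition star_balanced (R : realFieldType) (T : finType)
    (G : fuzzy_graph R T) : Prop :=
  forall H : fuzzy_graph R T,
    fuzzy_subgraph H G -> star_density H <= star_density G.

(* Main.v *)
Require Import Defs.
From HB Require Import structures.
From mathcomp Require Import all_boot all_order all_algebra.
Import Order.TTheory GRing.Theory Num.Theory.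
Local Open Scope ring_scope.

(** The point is that a fuzzy graph on [m] vertices has *-density at most
    [m - 1], whatever its membership functions. Indeed twice the sum of [mu]
    over unordered pairs is its sum over ordered pairs
    ([double_sum_mu]); charging each ordered pair [(u, v)] to its first vertex,
    where [mu u v <= sigma u], every vertex [u] pays at most [(m - 1) * sigma u]
    ([star_density_le_card]). When the graph is complete and [sigma] is
    constant, each charge [mu u v] is exactly [sigma u], so the bound is attained
    ([star_density_complete_constant]). A subgraph has no more vertices than the
    whole graph, hence its bound is no larger. *)

(** Ordered pairs of distinct vertices split according to which component comes
    first in the enumeration; symmetry of [mu] makes the two halves equal. *)
Lemma double_sum_mu (R : realFieldType) (T : finType) (G : fuzzy_graph R T) :
  2%:R * sum_mu G =
    \sum_(u in fvert G) \sum_(v in fvert G | v != u) fmu G u v.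
Proof.
have swap : sum_mu G = \sum_(u in fvert G)
    \sum_(v in fvert G | (enum_rank v < enum_rank u)%N) fmu G u v.
  rewrite /sum_mu (exchange_big_dep (mem (fvert G))) /=; last first.
    by move=> u v _ /andP[].
  apply: eq_bigr => v Gv; rewrite Gv.
  by apply: eq_bigr => u /andP[Gu _]; rewrite fmu_sym.
rewrite mulr_natl mulr2n {2}swap -big_split /=; apply: eq_bigr => u Gu.
rewrite [RHS](bigID (fun v => (enum_rank u < enum_rank v)%N)) /=.
congr (_ + _); apply: eq_bigl => v; case: (v \in fvert G) => //=.
  by case: eqVneq => // ->; rewrite ltnn.
by rewrite -leqNgt ltn_neqAle (inj_eq val_inj) (inj_eq enum_rank_inj).
Qed.

Lemma sum_sigma_gt0 (R : realFieldType) (T : finType) (G : fuzzy_graph R T) :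
  0 < \sum_(u in fvert G) fsigma G u.
Proof.
have sigma_gt0 u : u \in fvert G -> 0 < fsigma G u.
  by move=> /fsigma_range/andP[].
have [u Gu] := set0Pn _ (fvert_neq0 G).
rewrite (bigD1 u) //= ltr_wpDr ?sigma_gt0 //.
by apply: sumr_ge0 => v /andP[Gv _]; rewrite ltW ?sigma_gt0.
Qed.

Lemma sum_other_vertices (R : realFieldType) (T : finType) (A : {set T})
    (x : R) (u : T) :
  u \in A -> \sum_(v in A | v != u) x = (#|A|.-1)%:R * x.
Proof.
move=> Au; rewrite sumr_const mulr_natl (cardsD1 u A) Au /=.
by congr (_ *+ _); apply: eq_card => v; rewrite !inE andbC.
Qed.

Lemma star_density_le_card (R : realFieldType) (T : finType)
    (G : fuzzy_graph R T) :
  star_density G <= (#|fvert G|.-1)%:R.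
Proof.
rewrite /star_density ler_pdivrMr ?sum_sigma_gt0 // double_sum_mu mulr_sumr.
apply: ler_sum => u Gu; rewrite -(sum_other_vertices _ _ _ _ u Gu).
apply: ler_sum => v /andP[Gv v_neq_u].
have := @fmu_le _ _ G u v Gu Gv; rewrite eq_sym => /(_ v_neq_u).
by rewrite le_min => /andP[].
Qed.

Lemma star_density_complete_constant (R : realFieldType) (T : finType) (c : R)
    (G : fuzzy_graph R T) :
  complete_fuzzy G -> constant_sigma c G ->
  star_density G = (#|fvert G|.-1)%:R.
Proof.
move=> complG constG;
  apply: (canLR (mulfK _)); first exact: lt0r_neq0 (sum_sigma_gt0 _ _ _).
rewrite double_sum_mu mulr_sumr; apply: eq_bigr => u Gu.
rewrite -(sum_other_vertices _ _ _ _ u Gu); apply: eq_bigr => v /andP[Gv v_neq_u].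
by rewrite complG 1?eq_sym // !constG // minxx.
Qed.

Theorem theorem8 (R : realFieldType) (T : finType) (n : nat) (c : R)
    (K : fuzzy_graph R T) :
  (1 <= n)%N -> #|fvert K| = n ->
  complete_fuzzy K -> constant_sigma c K ->
  star_balanced K.
Proof.
move=> _ _ complK constK H [subHK _ _].
rewrite (star_density_complete_constant _ _ c K complK constK).
apply: le_trans (star_density_le_card _ _ H) _.
by rewrite ler_nat -!subn1 leq_sub2r // subset_leq_card.
Qed.
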